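(* Let $X$ be a complex Banach space, let $T \in L(X)$ and let $\Phi=(\Phi_1,\Phi_2)$ be a spectral partitioning function for $T$. If $\Psi=(\Psi_1,\Psi_2)$ is a spectral valued function such that $\Psi \leq \Phi$, then $\Psi$ is a spectral partitioning function for $T$ if and only if $\Psi_1(T) \setminus \Phi_1(T) = \Phi_2(T) \setminus \Psi_2(T)$.
   Context: $L(X)$ is the Banach algebra of bounded linear operators on $X$; $\sigma(T)$ is the spectrum of $T$; $\mathcal{P}(\mathbb{C})$ is the set of all subsets of $\mathbb{C}$. The symbol $\bigsqcup$ denotes disjoint union: $A = B \bigsqcup C$ means $A = B\cup C$ and $B\cap C=\emptyset$. A spectral valued function is a function $\Phi=(\Phi_1,\Phi_2): L(X)\to \mathcal{P}(\mathbb{C})\times\mathcal{P}(\mathbb{C})$ such that for every $S\in L(X)$, $\Phi_1(S)\subset\sigma(S)$ and $\Phi_2(S)\subset\sigma(S)$. A spectral valued function $\Phi$ is a spectral partitioning function for $T\in L(X)$ if $\sigma(T)=\Phi_1(T)\bigsqcup\Phi_2(T)$. For spectral valued functions $\Psi,\Phi$, write $\Psi\leq\Phi$ if for all $S\in L(X)$, $\Phi_1(S)\subset\Psi_1(S)$ and $\Psi_2(S)\subset\Phi_2(S)$. *)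

(* Defs.v *)
From HB Require Import structures.
From mathcomp Require Import all_boot all_order all_algebra.
From mathcomp Require Import all_classical all_reals all_analysis.
From mathcomp Require Import complex.

Set Implicit Arguments.
Unset Strict Implicit.
Unset Printing Implicit Defensive.

Import Order.TTheory GRing.Theory Num.Theory.
Import numFieldNormedType.Exports.

Local Open Scope classical_set_scope.
Local Open Scope ring_scope.
Local Open Scope complex_scope.

(* A complex Banach space is a completeNormedModType over C = R[i]. *)

Record bounded_operator (R : realType) (X : completeNormedModType R[i]) :=
  BoundedOperator {
    op_fun :> {linear X -> X};
    op_bounded : exists M : R[i], forall x : X, `|op_fun x| <= M * `|x| }.

Notation "''L' ( X )" := (bounded_operator X)
  (at level 8, format "''L' ( X )") : type_scope.

(* Equality in L(X) is pointwise, so a function out of 'L(X) depends only on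
   the underlying map of its argument. *)
Lemma bounded_operator_ext (R : realType) (X : completeNormedModType R[i])
  (S T : 'L(X)) : S =1 T -> S = T.
Proof.
case: S T => [s hs] [t ht] /= eq_st.
have {eq_st} e : s = t.
  case: s t {hs ht} eq_st => [f [[f1] [f2]]] [g [[g1] [g2]]] /= /funext e.
  by case: g / e g1 g2 => g1 g2; rewrite (Prop_irrelevance g1 f1)
    (Prop_irrelevance g2 f2).
by case: t / e ht => ht; congr BoundedOperator; exact: Prop_irrelevance.
Qed.

Lemma bounded_operator_continuous (R : realType)
  (X : completeNormedModType R[i]) (f : {linear X -> X}) :
  (exists M : R[i], forall x : X, `|f x| <= M * `|x|) <-> continuous f.
Proof.
rewrite -linear_bounded_continuous; split=> [[M fM]|].
  apply/bounded_funP => r.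
  exists (`|M| * `|r|) => x xr.
  have M0 : 0 <= M * `|x| by rewrite (le_trans _ (fM x)).
  rewrite (le_trans (fM x))// -(ger0_norm M0) normrM normr_id.
  by rewrite ler_wpM2l// (le_trans xr)// real_ler_norm// ger0_real//
    (le_trans _ xr).
by move=> /linear_boundedP/pinfty_ex_gt0[M _ fM]; exists M.
Qed.

(* lambda is in the spectrum when lambda I - T has no two-sided inverse
   belonging to L(X). *)
Definition spectrum (R : realType) (X : completeNormedModType R[i])
    (T : 'L(X)) : set R[i] :=
  [set lambda | ~ exists S : 'L(X),
     cancel (fun x : X => lambda *: x - T x) S /\
     cancel S (fun x : X => lambda *: x - T x)].

Definition is_disjoint_union (U : Type) (A B C : set U) : Prop :=
  A = B `|` C /\ B `&` C = set0.

Record spectral_valued_function (R : realType)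
    (X : completeNormedModType R[i]) := SpectralValuedFunction {
  svf_fun :> 'L(X) -> set R[i] * set R[i];
  svf_sub1 : forall S : 'L(X), (svf_fun S).1 `<=` spectrum S;
  svf_sub2 : forall S : 'L(X), (svf_fun S).2 `<=` spectrum S }.

Definition spectral_partitioning (R : realType)
    (X : completeNormedModType R[i]) (Phi : spectral_valued_function X)
    (T : 'L(X)) : Prop :=
  is_disjoint_union (spectrum T) (Phi T).1 (Phi T).2.

Definition svf_le (R : realType) (X : completeNormedModType R[i])
    (Psi Phi : spectral_valued_function X) : Prop :=
  forall S : 'L(X), (Phi S).1 `<=` (Psi S).1 /\ (Psi S).2 `<=` (Phi S).2.

(* Main.v *)
Require Import Defs.
From HB Require Import structures.
From mathcomp Require Import all_boot all_order all_algebra.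
From mathcomp Require Import all_classical all_reals all_analysis.
From mathcomp Require Import complex.

Local Open Scope classical_set_scope.
Local Open Scope ring_scope.
Local Open Scope complex_scope.

(** The statement is pure set theory at the single operator [T]. Given [A] split into [B] and [C],
    with [B] inside [D] inside [A] and [E] inside [C], the set [D \ B] is what [D] takes from [C],
    and [C \ E] is what [E] gives up. [D] and [E] split [A] exactly when these agree. *)

Lemma disjoint_union_transferP (U : Type) (A B C D E : set U) :
  is_disjoint_union A B C -> B `<=` D -> D `<=` A -> E `<=` C ->
  is_disjoint_union A D E <-> D `\` B = C `\` E.
Proof.
move=> [-> BC0] BD DBC EC; split=> [[BC_DE DE0]|DB_CE].
  apply/seteqP; split=> x [].
    move=> Dx nBx; split; first by case: (DBC x Dx).
    by move=> Ex; have : (D `&` E) x by []; rewrite DE0.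
  move=> Cx nEx; split.
    by have : (B `|` C) x by [right]; rewrite BC_DE => -[].
  by move=> Bx; have : (B `&` C) x by []; rewrite BC0.
split; apply/seteqP; split=> x //.
- case=> [/BD|Cx]; first by left.
  (* A point of [C] given up by [E] is picked up by [D]. *)
  have [Ex|nEx] := pselect (E x); first by right.
  by left; have : (C `\` E) x by []; rewrite -DB_CE => -[].
- by case=> [/DBC|/EC] //; right.
(* A common point of [D] and [E] lies in [C], hence off [B], hence in [D \ B = C \ E], contradicting
   membership in [E]. *)
- case=> Dx Ex; have Cx := EC x Ex.
  have nBx : ~ B x by move=> Bx; have : (B `&` C) x by []; rewrite BC0.
  by have : (D `\` B) x by []; rewrite DB_CE => -[].
Qed.

Theorem theorem2p5 (R : realType) (X : completeNormedModType R[i]) (T : 'L(X))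
    (Phi : spectral_valued_function X) (hPhi : spectral_partitioning Phi T)
    (Psi : spectral_valued_function X) (hle : svf_le Psi Phi) :
  spectral_partitioning Psi T <->
  (Psi T).1 `\` (Phi T).1 = (Phi T).2 `\` (Psi T).2.
Proof.
have [Phi1_sub Psi2_sub] := hle T.
(* Here [A] is the spectrum of [T]; it contains [D] because [Psi] is spectral valued. *)
exact: (disjoint_union_transferP _ _ _ _ _ _ hPhi Phi1_sub (@svf_sub1 _ _ Psi T) Psi2_sub).
Qed.
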